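(* Let $r,s$ be positive integers and for $n\in\mathbb{N}$ let $a_n(r,s)=\sum_{k\ge0}\binom{n}{k}^r\binom{n+k}{k}^s$. Then $$a_n(r,s)\equiv\begin{cases}(-1)^{\delta_3(n)}\pmod 3&\text{if } s \text{ is even},\\ 1\pmod 3&\text{if } s\text{ is odd and } n\in T(02),\\ 0\pmod 3&\text{otherwise.}\end{cases}$$
   Context: $\delta_3(n)$ denotes the number of digits equal to $1$ in the base-$3$ expansion of $n$. $T(02)$ denotes the set of $n\in\mathbb{N}$ whose base-$3$ expansion contains only the digits $0$ and $2$. *)

(* Defs.v *)
From mathcomp Require Import all_boot all_order all_algebra.

Set Implicit Arguments.
Unset Strict Implicit.
Unset Printing Implicit Defensive.

(* Base-3 expansion of n, least significant digit first; it has no leading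
   zeros for n > 0, and the expansion of 0 is the single digit 0. *)
Definition base3 (n : nat) : seq nat :=
  mkseq (fun i => (n %/ 3 ^ i) %% 3) (trunc_log 3 n).+1.

Definition delta3 (n : nat) : nat := count_mem 1 (base3 n).

Definition T02 : pred nat := [pred n | all [in [:: 0; 2]] (base3 n)].

(* The sum over all k >= 0 is truncated at k = n: since r > 0 in all uses, the
   terms with k > n vanish because 'C(n, k) = 0. *)
Definition apery (r s n : nat) : nat :=
  \sum_(0 <= k < n.+1) 'C(n, k) ^ r * 'C(n + k, k) ^ s.

(* Main.v *)
(** By Lucas' theorem modulo 3, the summand t(n, k) = C(n,k)^r C(n+k,k)^s
    satisfies t(3m + d, 3j + e) = t(m, j) t(d, e) in F_3 for digits d, e; when
    the addition d + e carries, both sides vanish because then 3 divides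
    C(d + e, e).  Summing over j and e, a_n is the product of the a_d over the
    base-3 digits d of n, and a_0 = a_2 = 1, a_1 = 1 + 2^s in F_3. *)
Require Import Defs.
From mathcomp Require Import all_boot all_order all_algebra.
From mathcomp Require Import zify.

Set Implicit Arguments.
Unset Strict Implicit.
Unset Printing Implicit Defensive.

Import Order.TTheory GRing.Theory Num.Theory.
Local Open Scope ring_scope.

Lemma eqz_mod3 (x y : int) : x%:~R = y%:~R :> 'F_3 -> (x = y %[mod 3])%Z.
Proof.
move=> xy; apply/eqP; rewrite eqz_mod_dvd.
by rewrite (dvdz_pcharf (pchar_Fp (isT : prime 3))) rmorphB /= xy subrr.
Qed.

Lemma natr_F3 (a q b : nat) : (a = 3 * q + b)%N -> a%:R = b%:R :> 'F_3.
Proof. by move=> ->; rewrite natrD natrM -Zp_nat_mod //= mul0r add0r. Qed.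

(** This is the coefficient of X^(k+3) in (1 + X)^(n+3) = (1 + X)^n (1 + X^3) over F_3. Three uses
    of Pascal's rule leave only the multiples 3 C(n,k+2) and 3 C(n,k+1) to discard. *)
Lemma natr_bin_add3 (n k : nat) :
  'C(n + 3, k + 3)%:R = 'C(n, k + 3)%:R + 'C(n, k)%:R :> 'F_3.
Proof.
rewrite -natrD; apply: (@natr_F3 _ ('C(n, k + 2) + 'C(n, k + 1))%N).
rewrite !addn3 !addn2 !addn1 !binS; lia.
Qed.

Lemma natr_bin_add3_small (n k : nat) :
  (k < 3)%N -> 'C(n + 3, k)%:R = 'C(n, k)%:R :> 'F_3.
Proof.
case: k => [|[|[|//]]] _; first by rewrite !bin0.
  by apply: (@natr_F3 _ 1); rewrite !bin1; lia.
by apply: (@natr_F3 _ n.+1); rewrite addn3 !binS !bin1 !bin0; lia.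
Qed.

(** Induction on [m]: raising [m] by 1 multiplies (1 + X)^(3m+d) by 1 + X^3, so the recurrence in
    steps of 3 becomes Pascal's rule for C(m,j). *)
Lemma lucas3 (m d j e : nat) : (d < 3)%N -> (e < 3)%N ->
  'C(3 * m + d, 3 * j + e)%:R = 'C(m, j)%:R * 'C(d, e)%:R :> 'F_3.
Proof.
move=> d3 e3; elim: m j => [|m IHm] [|j].
- by rewrite bin0 mul1r !muln0.
- by rewrite bin0n mul0r bin_small //; lia.
- have -> : (3 * m.+1 + d = 3 * m + d + 3)%N by lia.
  by rewrite muln0 natr_bin_add3_small // -[e](add0n) -(muln0 3) IHm !bin0.
have -> : (3 * m.+1 + d = 3 * m + d + 3)%N by lia.
have -> : (3 * j.+1 + e = 3 * j + e + 3)%N by lia.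
rewrite natr_bin_add3 IHm binS natrD mulrDl -!IHm; congr (_%:R + _).
by congr 'C(_, _); lia.
Qed.

Definition apery_term (r s n k : nat) : nat := 'C(n, k) ^ r * 'C(n + k, k) ^ s.

Lemma apery_term_lucas3 (r s m d j e : nat) :
  (d < 3)%N -> (e < 3)%N ->
  (apery_term r s (3 * m + d) (3 * j + e))%:R =
    (apery_term r s m j)%:R * (apery_term r s d e)%:R :> 'F_3.
Proof.
move=> d3 e3; rewrite /apery_term !natrM !natrX lucas3 //.
have -> : (3 * m + d + (3 * j + e) = 3 * (m + j) + (d + e))%N by lia.
suff -> : 'C(3 * (m + j) + (d + e), 3 * j + e)%:R =
    'C(m + j, j)%:R * 'C(d + e, e)%:R :> 'F_3.
  by rewrite !exprMn mulrACA.
have [de3|de3] := ltnP (d + e) 3; first exact: lucas3.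
(* The carrying pairs (1,2), (2,1), (2,2) give the values 3, 3, 6. *)
have -> : 'C(d + e, e)%:R = 0 :> 'F_3.
  by move: d e d3 e3 de3 => [|[|[|//]]] [|[|[|//]]] //= _ _ _; apply/val_inj.
(* After the carry the last digit d + e - 3 is less than e, so Lucas yields a zero factor. *)
have -> : (3 * (m + j) + (d + e) = 3 * (m + j).+1 + (d + e - 3))%N by lia.
by rewrite lucas3 ?[X in _ * X%:R]bin_small ?mulr0 //; lia.
Qed.

(** Freedom in the upper limit lets the sum for 3m + d run over complete blocks of three. *)
Lemma aperyE (r s n N : nat) : (0 < r)%N -> (n < N)%N ->
  apery r s n = (\sum_(0 <= k < N) apery_term r s n k)%N.
Proof.
move=> r0 nN; rewrite (big_cat_nat (leq0n n.+1) nN) /= [X in (_ + X)%N]big_nat.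
rewrite [X in (_ + X)%N]big1 ?addn0 // => k /andP[nk _].
by rewrite /apery_term bin_small // exp0n.
Qed.

Lemma apery_lucas3 (r s m d : nat) : (0 < r)%N -> (d < 3)%N ->
  (apery r s (3 * m + d))%:R = (apery r s m)%:R * (apery r s d)%:R :> 'F_3.
Proof.
move=> r0 d3.
rewrite (@aperyE _ _ _ (m.+1 * 3)) //; last by lia.
rewrite (@aperyE _ _ m m.+1) // (@aperyE _ _ d 3) //.
rewrite !natr_sum big_nat_mul mulr_suml; apply: eq_bigr => j _.
rewrite mulr_sumr mulSn addnC -{1}[(j * 3)%N]add0n big_addn addKn.
rewrite big_nat [RHS]big_nat; apply: eq_bigr => e /andP[_ e3].
by rewrite -apery_term_lucas3 // [(e + _)%N]addnC (mulnC j).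
Qed.

Lemma base3_digit (d : nat) : (d < 3)%N -> base3 d = [:: d].
Proof. by case: d => [|[|[|]]]. Qed.

Lemma base3_cons (m d : nat) : (0 < m)%N -> (d < 3)%N ->
  base3 (3 * m + d) = d :: base3 m.
Proof.
move=> m0 d3; rewrite /base3.
have -> : trunc_log 3 (3 * m + d) = (trunc_log 3 m).+1.
  apply: trunc_log_eq => //.
  (* From 3^t <= m < 3^(t+1) follows 3^(t+1) <= 3m + d < 3^(t+2), since 3m + d < 3(m + 1). *)
  have /andP[lo hi] := trunc_log_bounds (isT : (1 < 3)%N) m0.
  by rewrite !(expnS 3 _.+1) !(expnS 3 (trunc_log 3 m)) in hi *; lia.
rewrite /mkseq -[(trunc_log _ _).+2]add1n iotaD map_cat [(0 + 1)%N]addnC iotaDl.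
rewrite -map_comp [map _ (iota 0 1)]/= cat1s expn0 divn1 mulnC modnMDl modn_small //.
congr (_ :: _); apply: eq_map => i /=.
by rewrite add1n expnS divnMA divnMDl // (divn_small d3) addn0.
Qed.

Lemma base3_lt3 (n : nat) : all (fun d => d < 3)%N (base3 n).
Proof. by apply/allP => _ /mapP[i _ ->]; rewrite ltn_mod. Qed.

Lemma apery_prod_base3 (r s n : nat) : (0 < r)%N ->
  (apery r s n)%:R = \prod_(d <- base3 n) (apery r s d)%:R :> 'F_3.
Proof.
move=> r0; elim/ltn_ind: n => n IHn.
have [n3|n3] := ltnP n 3; first by rewrite base3_digit // big_seq1.
have m0 : (0 < n %/ 3)%N by rewrite divn_gt0.
have d3 : (n %% 3 < 3)%N by rewrite ltn_mod.
rewrite [in RHS](divn_eq n 3) mulnC base3_cons // big_cons -IHn; last by lia.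
by rewrite mulrC -apery_lucas3 // mulnC -divn_eq.
Qed.

(** The values are a_0 = 1, a_1 = 1 + 2^s = 1 + (-1)^s and a_2 = 1 + 2^r 3^s + 6^s, where s > 0
    kills the last two terms. *)
Lemma apery_digit (r s d : nat) : (0 < s)%N -> (d < 3)%N ->
  (apery r s d)%:R =
    if d == 1 then (if odd s then 0 else -1) else 1 :> 'F_3.
Proof.
have E2 : 2%:R = -1 :> 'F_3 by apply/val_inj.
have E3 : 3%:R = 0 :> 'F_3 by apply/val_inj.
have E6 : 6%:R = 0 :> 'F_3 by apply/val_inj.
move=> s0; case: d => [|[|[|//]]] _; rewrite /apery /index_iota /= unlock /=.
- by rewrite !exp1n.
- rewrite !exp1n !bin1 addn0 !mul1n -[(1 + 1)%N]/2%N natrD natrX E2 -signr_odd.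
  by case: (odd s); rewrite ?expr1 ?subrr.
- have -> : 'C(2 + 2, 2) = 6 by [].
  rewrite !exp1n !bin1 addn0 !mul1n -[(2 + 1)%N]/3%N !natrD natrM !natrX E3 E6.
  by rewrite expr0n eqn0Ngt s0 /= mulr0 !addr0.
Qed.

Theorem theorem5p7 (r s : nat) (hr : (0 < r)%N) (hs : (0 < s)%N) (n : nat) :
  ((apery r s n)%:Z =
     (if ~~ odd s then (-1) ^+ delta3 n
      else if n \in T02 then 1
      else 0) %[mod 3])%Z.
Proof.
apply: eqz_mod3; rewrite -[LHS]/((apery r s n)%:R) apery_prod_base3 //.
(* The claim is proved for every list of digits below 3: a digit 1 flips the sign when s is even and
   annihilates the product when s is odd. *)
rewrite /delta3 inE; elim: (base3 n) (base3_lt3 n) => [_|d ds IH /= /andP[d3 /IH]].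
  by rewrite big_nil; case: ifP.
rewrite big_cons apery_digit // => ->.
case: d d3 => [|[|[|//]]] _ /=; case: (odd s) => //=; rewrite ?mul1r ?mul0r //.
by rewrite add1n exprS rmorphM.
Qed.
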